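(* Let $A\in\mathbb{R}^{m\times n}$, let $B\in\mathbb{R}^{n\times n}$ be symmetric positive definite, and let $S$ be a random matrix with $m$ rows. Let $Z=A^\top S(S^\top AB^{-1}A^\top S)^\dagger S^\top A$, $d=\mathrm{Rank}(S^\top A)$ and $$\rho=1-\lambda_{\min}(B^{-1/2}\mathbf{E}[Z]B^{-1/2}).$$ Then $$0\le1-\frac{\mathbf{E}[d]}{n}\le\rho\le1 .$$ Furthermore, $$\rho=\left\|I-B^{-1/2}\mathbf{E}[Z]B^{-1/2}\right\|_2 .$$
   Context: $\dagger$ denotes the Moore–Penrose pseudoinverse, $\lambda_{\min}$ the smallest eigenvalue, $\|\cdot\|_2$ the spectral norm, and $B^{-1/2}$ the symmetric positive definite square root of $B^{-1}$. The number of columns of $S$ is arbitrary (possibly random). *)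

(* Defs.v *)
From HB Require Import structures.
From mathcomp Require Import all_boot all_order all_algebra.
From mathcomp Require Import all_classical all_reals all_analysis.

Set Implicit Arguments.
Unset Strict Implicit.
Unset Printing Implicit Defensive.

Import Order.TTheory GRing.Theory Num.Theory.
Local Open Scope classical_set_scope.
Local Open Scope ring_scope.

Section matrix_notions.
Context {R : realType}.

Definition sympd n (M : 'M[R]_n) : Prop :=
  M^T = M /\ forall x : 'cV[R]_n, x != 0 -> 0 < (x^T *m M *m x) 0 0.

(** The four Penrose equations; they have exactly one solution [X]. *)
Definition penrose p q (M : 'M[R]_(p, q)) (X : 'M[R]_(q, p)) : Prop :=
  [/\ M *m X *m M = M,
      X *m M *m X = X,
      (M *m X)^T = M *m X &
      (X *m M)^T = X *m M].

(** The default value [0] of [xget] is never reached: the Penrose equations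
    are always solvable. *)
Definition pinvmp p q (M : 'M[R]_(p, q)) : 'M[R]_(q, p) :=
  xget 0 [set X | penrose M X].

(** [B^{-1/2}]; the default value [0] is reached only when [B] is not symmetric
    positive definite. *)
Definition invsqrtmx n (B : 'M[R]_n) : 'M[R]_n :=
  xget 0 [set C : 'M[R]_n | sympd C /\ C *m C = invmx B].

(** The default value [0] is reached only when [M] has no real eigenvalue, which
    is impossible for a symmetric matrix of positive size. *)
Definition lambda_min n (M : 'M[R]_n) : R :=
  xget 0 [set a | eigenvalue M a /\ forall b, eigenvalue M b -> a <= b].

(** The norm on normed matrix spaces in the library is the maximum norm, so the
    Euclidean norm and its induced operator norm are written out. *)
Definition norm2 n (x : 'cV[R]_n) : R := Num.sqrt (\sum_i x i 0 ^+ 2).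

Definition specnorm p q (M : 'M[R]_(p, q)) : R :=
  sup [set norm2 (M *m x) | x in [set x : 'cV[R]_q | norm2 x <= 1]].

Definition Zmx m n k (A : 'M[R]_(m, n)) (B : 'M[R]_n) (S : 'M[R]_(m, k)) :
    'M[R]_n :=
  A^T *m S *m pinvmp (S^T *m A *m invmx B *m A^T *m S) *m S^T *m A.

End matrix_notions.

Section random_matrices.
Context {d : measure_display} {T : measurableType d} {R : realType}.

(** A random matrix with [m] rows and a random number [q w] of columns, i.e. a
    measurable map into the disjoint union over [k] of the spaces ['M[R]_(m, k)]
    with their Borel sigma-algebras. On the event [q w = k], [conform_mx]
    is the transport of [S w] to the type ['M[R]_(m, k)]. *)
Definition random_matrix m (q : T -> nat) (S : forall w : T, 'M[R]_(m, q w)) :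
    Prop :=
  forall k : nat,
    measurable [set w | q w = k] /\
    forall (i : 'I_m) (j : 'I_k),
      measurable_fun [set w | q w = k]
        (fun w => conform_mx (0 : 'M[R]_(m, k)) (S w) i j).

(** [fine] turns the extended real expectation into a real number; it loses
    information only when the expectation is infinite. *)
Definition expect (P : probability T R) (X : T -> R) : R := fine ('E_P[X])%E.

Definition expect_mx (P : probability T R) p q (M : T -> 'M[R]_(p, q)) :
    'M[R]_(p, q) :=
  \matrix_(i, j) expect P (fun w => M w i j).

End random_matrices.

(* Main.v *)
Require Import Defs.
From HB Require Import structures.
From mathcomp Require Import all_boot all_order all_algebra.
From mathcomp Require Import all_classical all_reals all_analysis.
From mathcomp Require Import complex measurable_realfun ring lra.

(** With [C = B^{-1/2}] and [M = S^T A C], the matrix [C Z C] equals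
    [M^T (M M^T)^+ M], the orthogonal projector onto the row space of [M]; its
    trace is its rank, which is [Rank (S^T A)]. Hence [W = C E[Z] C] satisfies
    [0 <= W <= I] and [tr W = E[d]], so its eigenvalues lie between 0 and 1 and
    the least of them is at most [tr W / n].

    That [Z] is integrable rests on its being a bounded measurable function of
    [S]: the pseudoinverse is discontinuous, but the projector is the
    pointwise limit of the Tikhonov regularizations
    [M^T (M M^T + t I)^{-1} M] as [t] tends to [0]. *)

Set Implicit Arguments.
Unset Strict Implicit.
Unset Printing Implicit Defensive.

Import Order.TTheory GRing.Theory Num.Theory.
Import numFieldNormedType.Exports.
Local Open Scope classical_set_scope.
Local Open Scope ring_scope.

(** * Spectral calculus for real symmetric matrices *)

(** The spectral theorem over the complex numbers diagonalizes [W] with real diagonal entries, so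
    the minimal polynomial is the product over the distinct ones. Minimal polynomials are preserved
    by field embeddings, which brings the factorization back to [R]. *)
Lemma symmetric_mxminpoly (R : rcfType) n (W : 'M[R]_n.+1) :
  W^T = W ->
  exists2 s : seq R, uniq s & mxminpoly W = \prod_(r <- s) ('X - r%:P).
Proof.
move=> Wsym.
pose f := real_complex R.
pose Wc := map_mx f W.
have Wcherm : Wc \is hermsymmx.
  apply: realsym_hermsym.
    by apply/is_hermitianmxP; rewrite expr0 scale1r map_mx_id// map_trmx Wsym.
  by apply/mxOverP => i j; rewrite mxE; apply/complex_realP; exists (W i j).
have [Q [sp [QVu WcE dreal]]] : exists Q sp, [/\ invmx Q \in unitmx,
    Wc = invmx Q *m diag_mx sp *m Q & forall i, sp 0 i \is Num.real].
  exists (spectralmx Wc), (spectral_diag Wc); split.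
  - by rewrite unitmx_inv; exact: spectral_unit.
  - exact/orthomx_spectralP/hermitian_normalmx.
  - by move=> i; exact/mxOverP/hermitian_spectral_diag_real.
have [u [uu minWc ureal]] : exists u, [/\ uniq u,
    mxminpoly Wc = \prod_(r <- u) ('X - r%:P) &
    {in u, forall z, z \is Num.real}].
  exists (undup [seq sp 0 i | i <- enum 'I_n.+1]); split.
  - exact: undup_uniq.
  - have -> : Wc = conjmx (invmx Q) (diag_mx sp).
      by rewrite (conjumx _ QVu) invmxK.
    by rewrite (mxminpoly_uconj _ QVu); exact: mxminpoly_diag.
  - by move=> z; rewrite mem_undup => /mapP[i _ ->]; exact: dreal.
have ReK : {in u, cancel (@complex.Re R) f}.
  by move=> z zu; exact: RRe_real (ureal z zu).
exists (map (@complex.Re R) u).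
  by rewrite (map_inj_in_uniq (can_in_inj ReK)).
apply: (map_poly_inj f).
rewrite -mxminpoly_map -/Wc minWc map_prod_XsubC big_map.
by apply: eq_big_seq => z zu; congr (_ - polyC _); exact/esym/ReK.
Qed.

(** Newton interpolation: [q] vanishes at the earlier nodes, so a multiple of it corrects the value
    at the new one. *)
Lemma interpolation (F : fieldType) (s : seq F) (f : F -> F) :
  exists p : {poly F}, {in s, forall a, p.[a] = f a}.
Proof.
elim: s => [|a s [p pE]]; first by exists 0.
have [as_|as_] := boolP (a \in s).
  by exists p => b; rewrite inE => /predU1P[->|]; exact: pE.
pose q := \prod_(b <- s) ('X - b%:P).
have qa : q.[a] != 0 by rewrite -/(root q a) root_prod_XsubC.
exists (p + ((f a - p.[a]) / q.[a]) *: q) => b.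
rewrite inE hornerD hornerZ => /predU1P[->|bs].
  by rewrite divfK// addrC subrK.
have /rootP -> : root q b by rewrite root_prod_XsubC.
by rewrite mulr0 addr0 pE.
Qed.

Lemma dotE (R : pzSemiRingType) n (x : 'cV[R]_n) :
  (x^T *m x) 0 0 = \sum_i x i 0 * x i 0.
Proof. by rewrite mxE; apply: eq_bigr => i _; rewrite mxE. Qed.

Lemma mxE_delta (R : pzSemiRingType) n (A : 'M[R]_n) i :
  ((delta_mx i 0 : 'cV_n)^T *m A *m delta_mx i (0 : 'I_1)) 0 0 = A i i.
Proof. by rewrite trmx_delta -rowE -colE !mxE. Qed.

Section positive_semidefinite.
Variable R : rcfType.

Lemma dot_ge0 n (x : 'cV[R]_n) : 0 <= (x^T *m x) 0 0.
Proof.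
by rewrite dotE sumr_ge0// => i _; rewrite -expr2 sqr_ge0.
Qed.

Lemma dot_eq0 n (x : 'cV[R]_n) : (x^T *m x) 0 0 = 0 -> x = 0.
Proof.
rewrite dotE => x0; apply/colP => i; rewrite mxE.
have sq_ge0 j : true -> 0 <= x j 0 * x j 0 by rewrite -expr2 sqr_ge0.
by have /(_ i isT)/eqP := psumr_eq0P sq_ge0 x0; rewrite mulf_eq0 orbb => /eqP.
Qed.

Lemma dot_gt0 n (x : 'cV[R]_n) : x != 0 -> 0 < (x^T *m x) 0 0.
Proof.
move=> x0; rewrite lt_neqAle dot_ge0 andbT eq_sym.
by apply: contra x0 => /eqP/dot_eq0 ->.
Qed.

Lemma gram_psd p r (M : 'M[R]_(p, r)) (x : 'cV_p) :
  0 <= (x^T *m (M *m M^T) *m x) 0 0.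
Proof. by rewrite mulmxA -mulmxA -[x^T *m M]trmxK trmx_mul trmxK dot_ge0. Qed.

Lemma mulmx_tr_eq0 p r (E : 'M[R]_(p, r)) : E *m E^T = 0 -> E = 0.
Proof.
move=> EE0; apply/row_matrixP => i; rewrite row0; apply: trmx_inj.
rewrite trmx0; apply: dot_eq0.
transitivity ((E *m E^T) i i); last by rewrite EE0 mxE.
by rewrite trmxK !mxE; apply: eq_bigr => j _; rewrite !mxE.
Qed.

End positive_semidefinite.

Section symmetric_functional_calculus.
Variables (R : rcfType) (n : nat) (W : 'M[R]_n.+1).
Hypothesis Wsym : W^T = W.

Lemma tr_horner_mx p : (horner_mx W p)^T = horner_mx W p.
Proof.
elim/poly_ind: p => [|p c IH]; first by rewrite rmorph0 trmx0.
rewrite rmorphD rmorphM /= horner_mx_X horner_mx_C linearD /= tr_scalar_mx.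
rewrite trmx_mul IH Wsym; congr (_ + _).
exact/esym/(comm_horner_mx p (comm_mx_refl W)).
Qed.

(** The roots of the minimal polynomial are simple and are the eigenvalues of [W], so it divides any
    polynomial vanishing at all of them. *)
Lemma eq_horner_mx (p r : {poly R}) :
  (forall a, eigenvalue W a -> p.[a] = r.[a]) -> horner_mx W p = horner_mx W r.
Proof.
move=> pr; apply/eqP; rewrite -subr_eq0 -rmorphB/=; apply/eqP.
have [s us ms] := symmetric_mxminpoly Wsym.
apply/mxminpoly_minP; rewrite ms; apply: uniq_roots_dvdp; last first.
  by rewrite uniq_rootsE.
apply/allP => a sa; apply/rootP; rewrite hornerD hornerN pr ?subrr//.
by rewrite eigenvalue_root_min ms root_prod_XsubC.
Qed.

(** Lets a polynomial in [W] stand for [f] applied to [W], even for a discontinuous [f] such as the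
    inverse extended by 0. *)
Lemma functional_calculus (f : R -> R) :
  exists p : {poly R}, forall a, eigenvalue W a -> p.[a] = f a.
Proof.
have [s us ms] := symmetric_mxminpoly Wsym.
have [p pE] := interpolation s f; exists p => a.
by rewrite eigenvalue_root_min ms root_prod_XsubC; exact: pE.
Qed.

(** On the spectrum [p] agrees with the square of a polynomial [r] that interpolates its square
    root, so [horner_mx W p] is a Gram matrix. *)
Lemma horner_mx_psd (p : {poly R}) :
  (forall a, eigenvalue W a -> 0 <= p.[a]) ->
  forall x : 'cV_n.+1, 0 <= (x^T *m horner_mx W p *m x) 0 0.
Proof.
move=> p_ge0 x; have [r rE] := functional_calculus (fun a => Num.sqrt p.[a]).
have -> : horner_mx W p = horner_mx W (r * r).
  by apply: eq_horner_mx => a Wa; rewrite hornerM rE// -expr2 sqr_sqrtr ?p_ge0.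
rewrite rmorphM /= -{1}(tr_horner_mx r).
by rewrite !mulmxA -trmx_mul -mulmxA dot_ge0.
Qed.

Lemma symmetric_eigenvalueP a :
  reflect (exists2 x : 'cV_n.+1, x != 0 & W *m x = a *: x) (eigenvalue W a).
Proof.
apply: (iffP (@eigenvalueP _ _ _ _)) => [[v vW v0]|[x x0 Wx]].
  exists v^T; first by rewrite trmx_eq0.
  by rewrite -{1}Wsym -trmx_mul vW linearZ.
exists x^T; last by rewrite trmx_eq0.
by rewrite -{1}Wsym -trmx_mul Wx linearZ.
Qed.

Lemma min_eigenvalue :
  exists2 a, eigenvalue W a & forall b, eigenvalue W b -> a <= b.
Proof.
have [s us ms] := symmetric_mxminpoly Wsym.
have sE b : eigenvalue W b = (b \in s).
  by rewrite eigenvalue_root_min ms root_prod_XsubC.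
case: s => [|c s] in us ms sE.
  (* An empty list of roots would make the minimal polynomial constant. *)
  have := size_mxminpoly W; rewrite ms big_nil size_poly1 => -[] /esym d0.
  by have := mxminpoly_nonconstant W; rewrite d0.
pose i0 : 'I_(size (c :: s)) := ord0.
case: (@arg_minP _ R _ i0 xpredT (fun i => (c :: s)`_i) isT) => i _ imin.
exists (c :: s)`_i; first by rewrite sE mem_nth.
move=> b; rewrite sE => bs.
have bi : (index b (c :: s) < size (c :: s))%N by rewrite index_mem.
by have := imin (Ordinal bi) isT; rewrite /= nth_index.
Qed.

Lemma rayleigh_ge a :
  (forall b, eigenvalue W b -> a <= b) ->
  forall x : 'cV_n.+1, a * (x^T *m x) 0 0 <= (x^T *m W *m x) 0 0.
Proof.
move=> amin x; rewrite -subr_ge0.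
have p_ge0 b : eigenvalue W b -> 0 <= ('X - a%:P).[b].
  by move=> Wb; rewrite hornerXsubC subr_ge0 amin.
have := horner_mx_psd p_ge0 x.
rewrite rmorphB /= horner_mx_X horner_mx_C mulmxBr mulmxBl.
by rewrite mul_mx_scalar -scalemxAl !mxE.
Qed.

End symmetric_functional_calculus.

(** * Pseudoinverse, square root and projectors *)

Section pseudo_inverse_and_root.
Variable R : realType.

Lemma penrose_pinvmp k (G : 'M[R]_k) : G^T = G -> penrose G (pinvmp G).
Proof.
move=> Gsym; suff ex : exists X, penrose G X by exact: xgetPex ex.
case: k => [|k] in G Gsym *; first by exists 0; split; apply/matrixP => -[].
(* As [0^-1 = 0], inverting every eigenvalue yields the pseudoinverse. *)
have [p pE] := functional_calculus Gsym GRing.inv.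
exists (horner_mx G p).
have GE : G = horner_mx G 'X by rewrite horner_mx_X.
have GX : G *m horner_mx G p = horner_mx G ('X * p) by rewrite rmorphM /= -GE.
have XG : horner_mx G p *m G = horner_mx G (p * 'X) by rewrite rmorphM /= -GE.
have aVa (a : R) : a * a^-1 * a = a.
  by have [->|a0] := eqVneq a 0; rewrite ?mulr0// mulfV// mul1r.
have VaV (a : R) : a^-1 * a * a^-1 = a^-1 by rewrite -{2}[a]invrK aVa.
split.
- rewrite GX {2 3}GE -[LHS]rmorphM; apply: (eq_horner_mx Gsym) => a Ga.
  by rewrite !hornerM hornerX pE.
- rewrite XG -[LHS]rmorphM; apply: (eq_horner_mx Gsym) => a Ga.
  by rewrite !hornerM hornerX pE.
- by rewrite GX tr_horner_mx.
- by rewrite XG tr_horner_mx.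
Qed.

Lemma invsqrtmxP n (B : 'M[R]_n) : sympd B ->
  sympd (invsqrtmx B) /\ invsqrtmx B *m invsqrtmx B = invmx B.
Proof.
move=> [Bsym Bpd]; suff ex : exists C, sympd C /\ C *m C = invmx B.
  exact: xgetPex ex.
case: n => [|n] in B Bsym Bpd *.
  exists 0; split; last by apply/matrixP => -[].
  by split=> [|x]; rewrite ?trmx0// flatmx0 eqxx.
have eig_gt0 a : eigenvalue B a -> 0 < a.
  move=> /(symmetric_eigenvalueP Bsym)[x x0 Bx].
  have := Bpd x x0; rewrite -mulmxA Bx -scalemxAr mxE.
  by rewrite pmulr_lgt0// dot_gt0.
have [p pE] := functional_calculus Bsym GRing.inv.
(* [Q] is a fourth root of [invmx B], so that [Q *m Q] is positive definite. *)
have [q qE] := functional_calculus Bsym (fun a => Num.sqrt (Num.sqrt a^-1)).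
pose Q := horner_mx B q.
have Qsym : Q^T = Q by exact: tr_horner_mx.
have BX : B *m horner_mx B p = 1%:M.
  rewrite -{1}(horner_mx_X B) -[LHS]rmorphM -[RHS](rmorph1 (horner_mx B)).
  apply: (eq_horner_mx Bsym) => a Ba.
  by rewrite hornerM hornerX hornerC pE// mulfV// gt_eqF// eig_gt0.
have BVE : invmx B = horner_mx B p.
  by have [Bu _] := mulmx1_unit BX; rewrite -[LHS]mulmx1 -BX mulKmx.
have QQE : (Q *m Q) *m (Q *m Q) = invmx B.
  rewrite BVE -[LHS]/((Q * Q) * (Q * Q)) /Q -!rmorphM.
  apply: (eq_horner_mx Bsym) => a Ba.
  rewrite !hornerM qE// pE// -!expr2 !sqr_sqrtr ?sqrtr_ge0//.
  by rewrite invr_ge0 ltW// eig_gt0.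
exists (Q *m Q); split=> //; split; first by rewrite trmx_mul Qsym.
move=> x x0; rewrite -{1}Qsym !mulmxA -trmx_mul -mulmxA.
rewrite lt_neqAle dot_ge0 andbT eq_sym; apply/negP => /eqP/dot_eq0 Qx0.
(* [x] equals [B] times the fourth power of [Q] applied to [x], hence vanishes once [Q *m x]
   does. *)
move: x0; rewrite -[x]mul1mx -BX -BVE -QQE -!mulmxA Qx0 !mulmx0.
by rewrite eqxx.
Qed.

End pseudo_inverse_and_root.

(** * Tikhonov regularization of a positive semidefinite matrix *)

Section tikhonov_regularization.
Variables (R : rcfType) (k : nat) (G : 'M[R]_k).
Hypotheses (Gsym : G^T = G) (Gpsd : forall x : 'cV_k, 0 <= (x^T *m G *m x) 0 0).

(** A row [v] in the kernel gives [v G v^T + t |v|^2 = 0], a sum of two nonnegative terms. *)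
Lemma psd_regularized_unit t : 0 < t -> G + t%:M \in unitmx.
Proof.
move=> t0; rewrite -row_free_unit; apply: inj_row_free => v.
rewrite mulmxDr mul_mx_scalar => /(congr1 (fun A => (A *m v^T) 0 0)).
rewrite mul0mx mulmxDl -scalemxAl [LHS]mxE [X in _ + X]mxE [RHS]mxE => v0.
have := Gpsd v^T; have := dot_ge0 v^T; rewrite trmxK => vv vGv.
apply: trmx_inj; rewrite trmx0; apply: dot_eq0; rewrite trmxK.
apply/eqP; rewrite eq_le vv andbT -(pmulr_rle0 _ t0).
by rewrite -v0 lerDr.
Qed.

(** With [Y] the inverse of [G + t I], one has [G Y G = G - t (I - t Y)]. The error is thus [t]
    times an entry of [N^T N - N^T (t Y) N], and [t Y] is a contraction, so this entry is bounded
    independently of [t]. *)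
Lemma tikhonov_bound n (N : 'M[R]_(k, n)) i j :
  exists K : R, forall t : R, 0 < t ->
  `|(N^T *m G *m N) i j
    - ((G *m N)^T *m invmx (G + t%:M) *m (G *m N)) i j| <= t * K.
Proof.
pose u := col i N; pose v := col j N.
exists (`|(N^T *m N) i j| + ((u^T *m u) 0 0 + (v^T *m v) 0 0)) => t t0.
have Gtu := psd_regularized_unit t0; set Y := invmx (G + t%:M).
have GY : G *m Y = 1%:M - t *: Y.
  by rewrite -(mulmxV Gtu) mulmxDl mul_scalar_mx addrK.
have YG : Y *m G = 1%:M - t *: Y.
  by rewrite -(mulVmx Gtu) mulmxDr mul_mx_scalar addrK.
have GYG : G *m Y *m G = G - t *: (1%:M - t *: Y).
  by rewrite GY mulmxBl mul1mx -scalemxAl YG.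
have MYM : (G *m N)^T *m Y *m (G *m N) =
    N^T *m G *m N - t *: (N^T *m N - N^T *m (t *: Y) *m N).
  rewrite trmx_mul Gsym mulmxA -(mulmxA N^T G Y) -(mulmxA N^T (G *m Y) G) GYG.
  rewrite mulmxBr mulmxBl; congr (_ - _).
  by rewrite -scalemxAr -scalemxAl mulmxBr mulmxBl mulmx1.
pose w := t *: Y *m v.
have Gw : G *m w + t *: w = t *: v.
  rewrite -mul_scalar_mx -mulmxDl /w -!scalemxAl -scalemxAr mulmxA.
  by rewrite mulmxV// mul1mx.
have addE (X Z : 'M[R]_1) : (X + Z) 0 0 = X 0 0 + Z 0 0 by rewrite mxE.
have scaleE e (X : 'M[R]_1) : (e *: X) 0 0 = e * X 0 0 by rewrite mxE.
have dotC (x y : 'cV[R]_k) : (x^T *m y) 0 0 = (y^T *m x) 0 0.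
  by rewrite -[y in LHS]trmxK -trmx_mul mxE.
have dotDsq (x y : 'cV[R]_k) (e : R) : ((x + e *: y)^T *m (x + e *: y)) 0 0 =
    (x^T *m x) 0 0 + e * (x^T *m y) 0 0 *+ 2 + e ^+ 2 * (y^T *m y) 0 0.
  rewrite [(x + _)^T]linearD linearZ /= mulmxDl !mulmxDr.
  by rewrite -!scalemxAl -!scalemxAr !(addE, scaleE) (dotC y x); ring.
(* Pairing [Gw] with [w] gives [|w|^2 <= <w, v>], because [G] is positive semidefinite; expanding
   [|w - v|^2 >= 0] then gives the claim. *)
have ww : (w^T *m w) 0 0 <= (v^T *m v) 0 0.
  have wGw := Gpsd w; have := dot_ge0 (w + (-1) *: v); rewrite dotDsq.
  have : (w^T *m (G *m w + t *: w)) 0 0 = (w^T *m (t *: v)) 0 0 by rewrite Gw.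
  rewrite mulmxDr -!scalemxAr !(addE, scaleE) mulmxA => E1 E2.
  have : (w^T *m w) 0 0 <= (w^T *m v) 0 0.
    by rewrite -(ler_pM2l t0) -E1 lerDr.
  by lra.
(* A weak form of Cauchy-Schwarz, from the nonnegativity of [|u + w|^2] and [|u - w|^2]. *)
have uw : `|(u^T *m w) 0 0| <= (u^T *m u) 0 0 + (v^T *m v) 0 0.
  have := dot_ge0 (u + (-1) *: w); have := dot_ge0 (u + 1 *: w).
  have := dot_ge0 u; have := dot_ge0 v; rewrite !dotDsq ler_norml.
  by move=> ? ? ? ?; apply/andP; split; lra.
have NYN : (N^T *m (t *: Y) *m N) i j = (u^T *m w) 0 0.
  rewrite /w /u /v tr_col mulmxA -row_mul [RHS]mxE [LHS]mxE.
  by apply: eq_bigr => l _; rewrite [row _ _ _ _]mxE [col _ _ _ _]mxE.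
have entryE (X Z V : 'M[R]_n) :
    X i j - (X - t *: (Z - V)) i j = t * (Z i j - V i j).
  by rewrite !mxE; ring.
rewrite MYM entryE NYN normrM gtr0_norm// ler_pM2l//.
by rewrite (le_trans (ler_normB _ _))// lerD2l.
Qed.

End tikhonov_regularization.

(** * Orthogonal projectors, and the projector onto a row space *)

Section orthogonal_projector.
Variables (R : rcfType) (n : nat) (E : 'M[R]_n).
Hypotheses (Esym : E^T = E) (Eidem : E *m E = E).

Lemma qform_projector (x : 'cV_n) :
  (x^T *m E *m x) 0 0 = ((E *m x)^T *m (E *m x)) 0 0.
Proof. by rewrite trmx_mul Esym mulmxA -(mulmxA x^T E E) Eidem. Qed.

Lemma qform_projector_ge0 (x : 'cV_n) : 0 <= (x^T *m E *m x) 0 0.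
Proof. by rewrite qform_projector dot_ge0. Qed.

(** The difference of the two sides is the squared norm of [x - E *m x]. *)
Lemma qform_projector_le (x : 'cV_n) :
  (x^T *m E *m x) 0 0 <= (x^T *m x) 0 0.
Proof.
have := dot_ge0 (x - E *m x).
rewrite [(x - _)^T]linearB /= mulmxBl !mulmxBr trmx_mul Esym !mulmxA.
rewrite -(mulmxA x^T E E) Eidem subrr subr0.
by rewrite [X in 0 <= X -> _]mxE [X in _ + X]mxE subr_ge0.
Qed.

(** By symmetry and idempotence [E j j] is the squared norm of column [j], and it is at most 1. This
    uniform bound is what makes a random projector integrable. *)
Lemma projector_entry_le1 i j : `|E i j| <= 1.
Proof.
have jj_le1 : E j j <= 1.
  have := qform_projector_le (delta_mx j 0).
  rewrite mxE_delta -[X in _ <= (_ *m X) _ _]mul1mx mulmxA mxE_delta.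
  by rewrite mxE eqxx.
have sq_le : E i j ^+ 2 <= E j j.
  have -> : E j j = \sum_l E l j ^+ 2.
    rewrite -[in LHS]Eidem mxE; apply: eq_bigr => l _.
    by rewrite -{1}Esym mxE expr2.
  by rewrite (bigD1 i)//= lerDl sumr_ge0// => l _; rewrite sqr_ge0.
by rewrite -(expr_le1 (n := 2))// -normrX ger0_norm ?sqr_ge0// (le_trans sq_le).
Qed.

End orthogonal_projector.

Section row_space_projector.
Variables (R : realType) (k n : nat) (M : 'M[R]_(k, n)).

Let G := M *m M^T.
Definition row_proj : 'M[R]_n := M^T *m pinvmp (M *m M^T) *m M.

Let Gsym : G^T = G. Proof. by rewrite /G trmx_mul trmxK. Qed.

(** The difference of the two sides is [D M] with [D = G G^+ - I], and [D M (D M)^T = D G D^T]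
    vanishes by the first Penrose equation. *)
Let pinvmpK : G *m pinvmp G *m M = M.
Proof.
have [GXG _ _ _] := penrose_pinvmp Gsym.
apply/eqP; rewrite -subr_eq0 -{2}[M]mul1mx -mulmxBl; apply/eqP/mulmx_tr_eq0.
by rewrite trmx_mul mulmxA -(mulmxA _ M) -/G mulmxBl GXG mul1mx subrr mul0mx.
Qed.

Lemma mulmx_row_proj : M *m row_proj = M.
Proof. by rewrite /row_proj !mulmxA -/G pinvmpK. Qed.

Let N := pinvmp G *m M.
Let GN : G *m N = M. Proof. by rewrite /N mulmxA pinvmpK. Qed.

(** This form shows symmetry without any symmetry of [pinvmp G], and it is the one that
    [tikhonov_bound] approximates. *)
Let projE : row_proj = N^T *m G *m N.
Proof.
have -> : N^T *m G = M^T by rewrite -[in RHS]GN [in RHS]trmx_mul Gsym.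
by rewrite /N mulmxA.
Qed.

Lemma tr_row_proj : row_proj^T = row_proj.
Proof. by rewrite projE [LHS]trmx_mul (trmx_mul N^T) trmxK Gsym mulmxA. Qed.

Lemma row_proj_idem : row_proj *m row_proj = row_proj.
Proof. by rewrite {1}/row_proj -mulmxA mulmx_row_proj. Qed.

Lemma rank_row_proj : \rank row_proj = \rank M.
Proof.
apply/eqP; rewrite eqn_leq mxrankM_maxr /=.
by rewrite -{1}mulmx_row_proj mxrankM_maxr.
Qed.

Lemma row_projE : exists N, M = G *m N /\ row_proj = N^T *m G *m N.
Proof. by exists N. Qed.

End row_space_projector.

(** In a full rank factorization [E = L U], idempotence gives [U L = I] after cancelling [L] on the
    left and [U] on the right. The trace of [L U] is then that of an identity matrix whose size is
    the rank. *)
Lemma mxtrace_idem (F : fieldType) n (E : 'M[F]_n) :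
  E *m E = E -> \tr E = (\rank E)%:R.
Proof.
move=> EE.
have /row_fullP[V] := col_base_full E; have /row_freeP[Z] := row_base_free E.
have := mulmx_base E; move: (col_base E) (row_base E) => L U LU UZ VL.
have UL : U *m L = 1%:M.
  have LULU : L *m U *m (L *m U) = L *m U by rewrite LU.
  have /(congr1 (fun X => V *m X *m Z)) := LULU.
  by rewrite !mulmxA VL mul1mx -!mulmxA UZ mulmx1.
by rewrite -[in LHS]LU mxtrace_mulC UL mxtrace1.
Qed.

(** * Measurability *)

Section measurable_matrices.
Context {d : measure_display} {T : measurableType d} {R : realType}.
Implicit Types D : set T.

(** Inversion is continuous only away from 0, hence the composition through the open set of nonzero
    reals. *)
Lemma measurable_funV D (f : T -> R) :
  (forall w, D w -> f w != 0) -> measurable_fun D f ->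
  measurable_fun D (fun w => (f w)^-1).
Proof.
move=> f0 mf; have oF : open [set x : R | x != 0].
  rewrite [X in open X](_ : _ = ~` [set 0]); first exact: closed_openC.
  by apply/seteqP; split=> x /eqP.
apply: (measurable_comp (F := [set x : R | x != 0])) mf.
- exact: open_measurable.
- by move=> _ [w Dw <-]; exact: f0.
- apply: open_continuous_measurable_fun => // x /[!inE].
  exact: inv_continuous.
Qed.

Definition measurable_mx D p q (M : T -> 'M[R]_(p, q)) :=
  forall i j, measurable_fun D (fun w => M w i j).

Lemma measurable_mx_cst D p q (M : 'M[R]_(p, q)) : measurable_mx D (fun=> M).
Proof. by move=> i j; exact: measurable_cst. Qed.

Lemma measurable_mx_tr D p q (M : T -> 'M[R]_(p, q)) :
  measurable_mx D M -> measurable_mx D (fun w => (M w)^T).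
Proof. by move=> mM i j; under eq_fun do rewrite mxE; exact: mM. Qed.

Lemma measurable_mxD D p q (M N : T -> 'M[R]_(p, q)) :
  measurable_mx D M -> measurable_mx D N ->
  measurable_mx D (fun w => M w + N w).
Proof.
move=> mM mN i j; under eq_fun do rewrite mxE.
exact: measurable_funD (mM i j) (mN i j).
Qed.

Lemma measurable_mxM D p q r (M : T -> 'M[R]_(p, q)) (N : T -> 'M[R]_(q, r)) :
  measurable_mx D M -> measurable_mx D N ->
  measurable_mx D (fun w => M w *m N w).
Proof.
move=> mM mN i j; under eq_fun do rewrite mxE.
by apply: measurable_sum => l; exact: measurable_funM (mM i l) (mN l j).
Qed.

Lemma measurable_det D p (M : T -> 'M[R]_p) :
  measurable_mx D M -> measurable_fun D (fun w => \det (M w)).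
Proof.
move=> mM; apply: measurable_sum => s.
apply: measurable_funM; first exact: measurable_cst.
by apply: measurable_prod => i _; exact: mM.
Qed.

(** Cramer's rule: each entry of the inverse is a cofactor divided by the determinant. *)
Lemma measurable_invmx D p (M : T -> 'M[R]_p) :
  (forall w, D w -> M w \in unitmx) ->
  measurable_mx D M -> measurable_mx D (fun w => invmx (M w)).
Proof.
move=> uM mM i j.
apply: (eq_measurable_fun (fun w => (\det (M w))^-1 * cofactor (M w) j i)).
  by move=> w /[!inE] /uM Mu; rewrite /invmx Mu !mxE.
apply: measurable_funM.
  apply: measurable_funV; last exact: measurable_det.
  by move=> w /uM; rewrite unitmxE unitfE.
apply: measurable_funM; first exact: measurable_cst.
apply: measurable_det => a b; under eq_fun do rewrite !mxE; exact: mM.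
Qed.

(** The sequence [harmonic] serves as regularization parameter: it is positive and tends to 0, so
    [tikhonov_bound] squeezes the entry. *)
Lemma row_proj_cvg k n (M : 'M[R]_(k, n)) i j :
  (M^T *m invmx (M *m M^T + (harmonic l)%:M) *m M) i j @[l --> \oo]
    --> row_proj M i j.
Proof.
have Gsym : (M *m M^T)^T = M *m M^T by rewrite trmx_mul trmxK.
have [N [MGN ->]] := row_projE M.
have [K HK] := tikhonov_bound Gsym (gram_psd M) N i j.
rewrite -MGN in HK.
have hK (e : R) :
    (N^T *m (M *m M^T) *m N) i j + e * (harmonic l * K) @[l --> \oo]
      --> (N^T *m (M *m M^T) *m N) i j.
  rewrite -[X in _ --> X]addr0 -(mulr0 e) -(mul0r K).
  apply: cvgD; first exact: cvg_cst.
  apply: cvgM; first exact: cvg_cst.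
  by apply: cvgM; [exact: cvg_harmonic|exact: cvg_cst].
apply: squeeze_cvgr (hK (-1)) (hK 1).
near=> l; have := HK (harmonic l) (harmonic_gt0 l).
by rewrite ler_norml => /andP[? ?]; apply/andP; split; lra.
Unshelve. all: by end_near. Qed.

Lemma measurable_row_proj D k n (M : T -> 'M[R]_(k, n)) :
  measurable_mx D M -> measurable_mx D (fun w => row_proj (M w)).
Proof.
move=> mM i j.
apply: (measurable_fun_cvg (h := fun l w =>
  ((M w)^T *m invmx (M w *m (M w)^T + (harmonic l)%:M) *m M w) i j)).
  move=> l; apply: measurable_mxM => //; apply: measurable_mxM.
    exact: measurable_mx_tr.
  apply: measurable_invmx => [w _|].
    by apply: psd_regularized_unit (harmonic_gt0 l); exact: gram_psd.
  apply: measurable_mxD; last exact: measurable_mx_cst.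
  by apply: measurable_mxM => //; exact: measurable_mx_tr.
by move=> w _; exact: row_proj_cvg.
Qed.

Lemma measurable_random_row_proj m n (q : T -> nat)
    (S : forall w, 'M[R]_(m, q w)) (A : 'M[R]_(m, n)) :
  random_matrix S -> measurable_mx setT (fun w => row_proj ((S w)^T *m A)).
Proof.
move=> mS i j.
(* Countably many events fix the number of columns; on each of them [S w] can be transported to a
   constant type, where entrywise measurability makes sense. *)
have -> : [set: T] = \bigcup_k [set w | q w = k].
  by apply/seteqP; split => // w _; exists (q w).
apply/measurable_fun_bigcup => k; first by have [] := mS k.
have [_ mSk] := mS k.
apply: (eq_measurable_fun (fun w =>
  row_proj ((conform_mx (0 : 'M[R]_(m, k)) (S w))^T *m A) i j)).
  move=> w /[!inE] /= qw; move: (S w); rewrite qw => Sw.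
  by rewrite conform_mx_id.
apply: measurable_row_proj; apply: measurable_mxM.
  by apply: measurable_mx_tr => a b; exact: mSk.
exact: measurable_mx_cst.
Qed.

End measurable_matrices.

(** * Expectation and the extreme eigenvalue *)

Section euclidean_norm.
Variable R : realType.

Lemma norm2E p (x : 'cV[R]_p) : norm2 x = Num.sqrt ((x^T *m x) 0 0).
Proof. by rewrite dotE. Qed.

Lemma norm2Z p a (x : 'cV[R]_p) : norm2 (a *: x) = `|a| * norm2 x.
Proof.
rewrite !norm2E [(a *: x)^T]linearZ /= -scalemxAl -scalemxAr scalerA mxE -expr2.
by rewrite sqrtrM ?sqr_ge0// sqrtr_sqr.
Qed.

End euclidean_norm.

Section spectrum_between_zero_and_one.
Variables (R : realType) (n : nat) (W : 'M[R]_n.+1).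
Hypothesis Wsym : W^T = W.
Hypothesis W_ge0 : forall x : 'cV_n.+1, 0 <= (x^T *m W *m x) 0 0.
Hypothesis W_le1 : forall x : 'cV_n.+1, (x^T *m W *m x) 0 0 <= (x^T *m x) 0 0.

Lemma lambda_minP :
  eigenvalue W (lambda_min W) /\ forall b, eigenvalue W b -> lambda_min W <= b.
Proof.
have [a Wa amin] := min_eigenvalue Wsym.
by apply: (@xgetPex _ _ [set a | eigenvalue W a /\ _]); exists a.
Qed.

Lemma eigenvalue_itv a : eigenvalue W a -> 0 <= a <= 1.
Proof.
move=> /(symmetric_eigenvalueP Wsym)[x x0 Wx].
have xx0 := dot_gt0 x0.
have := W_ge0 x; have := W_le1 x.
rewrite -mulmxA Wx -scalemxAr [(_ *: (x^T *m x)) 0 0]mxE.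
by rewrite pmulr_lge0// ger_pMl// => -> ->.
Qed.

Lemma lambda_min_diag i : lambda_min W <= W i i <= 1.
Proof.
have [_ lmin] := lambda_minP.
have dd : ((delta_mx i 0 : 'cV[R]_n.+1)^T *m delta_mx i (0 : 'I_1)) 0 0 = 1.
  by rewrite -[X in (X *m _) _ _]mulmx1 mxE_delta mxE eqxx.
have := rayleigh_ge Wsym lmin (delta_mx i 0); have := W_le1 (delta_mx i 0).
by rewrite mxE_delta dd mulr1 => -> ->.
Qed.

(** Diagonal entries are Rayleigh quotients at basis vectors; summing their bounds avoids writing
    the trace as a sum of eigenvalues with multiplicity. *)
Lemma lambda_min_mxtrace : lambda_min W * n.+1%:R <= \tr W <= n.+1%:R.
Proof.
have -> : lambda_min W * n.+1%:R = \sum_(i < n.+1) lambda_min W.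
  by rewrite sumr_const card_ord mulr_natr.
have -> : n.+1%:R = \sum_(i < n.+1) 1 :> R by rewrite sumr_const card_ord.
by apply/andP; split; apply: ler_sum => i _; have /andP[] := lambda_min_diag i.
Qed.

(** With [l] the least eigenvalue, all eigenvalues lie between [l] and 1, so
    [(1 - l)^2 - (1 - 'X)^2] is nonnegative on the spectrum. This bounds the norm from above, and a
    unit eigenvector for [l] attains the bound. *)
Lemma specnorm_one_minus : specnorm (1%:M - W) = 1 - lambda_min W.
Proof.
rewrite /specnorm; have [Wl lmin] := lambda_minP.
set l := lambda_min W in Wl lmin *.
have /andP[l0 l1] := eigenvalue_itv Wl.
have Vsym : (1%:M - W)^T = 1%:M - W by rewrite linearB /= trmx1 Wsym.
have ub (x : 'cV_n.+1) : norm2 x <= 1 -> norm2 ((1%:M - W) *m x) <= 1 - l.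
  move=> x1; apply: (@le_trans _ _ ((1 - l) * norm2 x)); last first.
    by rewrite ler_piMr// subr_ge0.
  have <- : Num.sqrt ((1 - l) ^+ 2) = 1 - l.
    by rewrite sqrtr_sqr ger0_norm// subr_ge0.
  rewrite !norm2E -sqrtrM ?sqr_ge0//; apply: ler_wsqrtr.
  have p_ge0 b : eigenvalue W b ->
      0 <= (((1 - l) ^+ 2)%:P - (1%:P - 'X) ^+ 2).[b].
    move=> Wb; have := lmin b Wb; have /andP[b0 b1] := eigenvalue_itv Wb.
    by rewrite !hornerE => lb; nra.
  have hE c : horner_mx W (c%:P - (1%:P - 'X) ^+ 2) =
      c%:M - (1%:M - W) *m (1%:M - W).
    by rewrite [LHS]rmorphB rmorphXn rmorphB /= !horner_mx_C horner_mx_X.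
  have entryE c (Z Y : 'M[R]_1) : (c *: Z - Y) 0 0 = c * Z 0 0 - Y 0 0.
    by rewrite !mxE.
  have := horner_mx_psd Wsym p_ge0 x.
  rewrite hE mulmxBr mulmxBl mul_mx_scalar -scalemxAl entryE subr_ge0.
  by rewrite trmx_mul Vsym !mulmxA.
have [x0 x00 Wx0] := symmetric_eigenvalueP Wsym _ Wl.
have nx0 : 0 < norm2 x0 by rewrite norm2E sqrtr_gt0 dot_gt0.
pose x := (norm2 x0)^-1 *: x0.
have x1 : norm2 x = 1 by rewrite norm2Z gtr0_norm ?invr_gt0// mulVf// gt_eqF.
have Vx : norm2 ((1%:M - W) *m x) = 1 - l.
  have -> : (1%:M - W) *m x = (1 - l) *: x.
    rewrite mulmxBl mul1mx scalerBl scale1r; congr (_ - _).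
    by rewrite -scalemxAr Wx0 !scalerA mulrC.
  by rewrite norm2Z x1 mulr1 ger0_norm// subr_ge0.
set V := [set norm2 _ | _ in _].
have mem : V (1 - l) by exists x; rewrite //= x1.
have sub : ubound V (1 - l) by move=> _ [y y1 <-]; exact: ub.
apply/eqP; rewrite eq_le; apply/andP; split.
  by apply: ge_sup => //; exists (1 - l).
by apply: ub_le_sup => //; exists (1 - l).
Qed.

End spectrum_between_zero_and_one.

(** * Linearity of the expectation of random matrices *)

Section expectation_of_matrices.
Context {d : measure_display} {T : measurableType d} {R : realType}.
Variable P : probability T R.

Lemma expectE (X : T -> R) : expect P X = \int[P]_w X w.
Proof. by rewrite /expect unlock. Qed.

Lemma bounded_integrable (X : T -> R) K : measurable_fun setT X ->
  (forall w, `|X w| <= K) -> P.-integrable setT (EFin \o X).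
Proof.
move=> mX XK; apply: measurable_bounded_integrable => //.
  by apply: (le_lt_trans (probability_le1 P measurableT)); exact: ltry.
exists K; split; first exact: num_real.
by move=> M KM w _; exact: le_trans (XK w) (ltW KM).
Qed.

Lemma integrable_lincomb (I : Type) (s : seq I) (a : I -> R) (h : I -> T -> R) :
  (forall i, P.-integrable setT (EFin \o h i)) ->
  P.-integrable setT (EFin \o (fun w => \sum_(i <- s) a i * h i w)).
Proof.
move=> ih; rewrite [X in integrable _ _ X](_ : _ =
    fun w => (\sum_(i <- s) (a i)%:E * (EFin \o h i) w)%E); last first.
  by apply/funext => w /=; rewrite sumEFin.
by apply: integrable_sum => // i _; exact: integrableZl.
Qed.

(** Common source of the rules for products with a constant matrix and, with all coefficients 1, for
    the trace. *)
Lemma expect_lincomb (I : Type) (s : seq I) (a : I -> R) (h : I -> T -> R) :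
  (forall i, P.-integrable setT (EFin \o h i)) ->
  expect P (fun w => \sum_(i <- s) a i * h i w) =
  \sum_(i <- s) a i * expect P (h i).
Proof.
move=> ih; elim: s => [|i s IH].
  under eq_fun do rewrite big_nil.
  by rewrite expectE Rintegral_cst// mul0r big_nil.
under eq_fun do rewrite big_cons; rewrite big_cons -IH !expectE.
rewrite RintegralD//; first by rewrite RintegralZl.
- exact: (integrableZl measurableT (a i) (ih i)).
- exact: integrable_lincomb.
Qed.

Definition integrable_mx p q (M : T -> 'M[R]_(p, q)) :=
  forall i j, P.-integrable setT (EFin \o (fun w => M w i j)).

Lemma integrable_mulmxl p q r (L : 'M[R]_(p, q)) (M : T -> 'M[R]_(q, r)) :
  integrable_mx M -> integrable_mx (fun w => L *m M w).
Proof.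
move=> iM i j; under eq_fun do rewrite mxE.
exact: (integrable_lincomb _ _ (fun l => iM l j)).
Qed.

Lemma expect_mulmxl p q r (L : 'M[R]_(p, q)) (M : T -> 'M[R]_(q, r)) :
  integrable_mx M -> expect_mx P (fun w => L *m M w) = L *m expect_mx P M.
Proof.
move=> iM; apply/matrixP => i j; rewrite !mxE; under eq_fun do rewrite mxE.
rewrite (expect_lincomb _ _ (fun l => iM l j)).
by apply: eq_bigr => l _; rewrite mxE.
Qed.

Lemma expect_mx_tr p q (M : T -> 'M[R]_(p, q)) :
  expect_mx P (fun w => (M w)^T) = (expect_mx P M)^T.
Proof. by apply/matrixP => i j; rewrite !mxE; under eq_fun do rewrite mxE. Qed.

Lemma expect_mulmxr p q r (M : T -> 'M[R]_(p, q)) (L : 'M[R]_(q, r)) :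
  integrable_mx M -> expect_mx P (fun w => M w *m L) = expect_mx P M *m L.
Proof.
move=> iM; apply: trmx_inj; rewrite trmx_mul -!expect_mx_tr -expect_mulmxl.
  by congr expect_mx; apply/funext => w; rewrite trmx_mul.
by move=> i j; under eq_fun do rewrite mxE; exact: iM.
Qed.

Lemma integrable_mulmxr p q r (M : T -> 'M[R]_(p, q)) (L : 'M[R]_(q, r)) :
  integrable_mx M -> integrable_mx (fun w => M w *m L).
Proof.
move=> iM i j; under eq_fun do rewrite mxE.
under eq_fun do under eq_bigr do rewrite mulrC.
exact: (integrable_lincomb _ _ (fun l => iM i l)).
Qed.

Lemma expect_mxtrace n (M : T -> 'M[R]_n) : integrable_mx M ->
  expect P (fun w => \tr (M w)) = \tr (expect_mx P M).
Proof.
move=> iM; have := expect_lincomb (index_enum 'I_n) (fun=> 1) (fun i => iM i i).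
under eq_fun do under eq_bigr do rewrite mul1r.
by move=> ->; apply: eq_bigr => i _; rewrite mul1r mxE.
Qed.

Lemma expect_qform n (M : T -> 'M[R]_n) (x : 'cV_n) : integrable_mx M ->
  (x^T *m expect_mx P M *m x) 0 0 = expect P (fun w => (x^T *m M w *m x) 0 0).
Proof.
move=> iM; rewrite -expect_mulmxl// -expect_mulmxr ?mxE//.
exact: integrable_mulmxl.
Qed.

End expectation_of_matrices.

Lemma sympd_unitmx (R : realType) n (C : 'M[R]_n) : sympd C -> C \in unitmx.
Proof.
move=> [_ Cpd]; rewrite -row_free_unit; apply: inj_row_free => v vC0.
apply/eqP; rewrite -trmx_eq0; apply/negPn/negP => /Cpd.
by rewrite trmxK vC0 mul0mx mxE ltxx.
Qed.

(** Since [C] squares to the inverse of [B], the matrix under the pseudoinverse in [Zmx] is [M M^T]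
    for [M = S^T A C]. *)
Lemma conj_Zmx (R : realType) m n k (A : 'M[R]_(m, n)) (B C : 'M[R]_n)
    (S : 'M[R]_(m, k)) : C^T = C -> C *m C = invmx B ->
  C *m Zmx A B S *m C = row_proj (S^T *m (A *m C)).
Proof.
move=> Csym CC; rewrite /Zmx -CC /row_proj !trmx_mul trmxK Csym.
by rewrite !mulmxA.
Qed.

Theorem lemma13 (R : realType) (d : measure_display) (T : measurableType d)
    (P : probability T R) (m n : nat) (hn : (0 < n)%N)
    (A : 'M[R]_(m, n)) (B : 'M[R]_n) (hB : sympd B)
    (q : T -> nat) (S : forall w : T, 'M[R]_(m, q w)) (hS : random_matrix S) :
  let EZ := expect_mx P (fun w => Zmx A B (S w)) in
  let Ed := expect P (fun w => (\rank ((S w)^T *m A))%:R) in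
  let rho := 1 - lambda_min (invsqrtmx B *m EZ *m invsqrtmx B) in
  [/\ 0 <= 1 - Ed / n%:R,
      1 - Ed / n%:R <= rho,
      rho <= 1 &
      rho = specnorm (1%:M - invsqrtmx B *m EZ *m invsqrtmx B)].
Proof.
case: n hn A B hB => [//|n] _ A B hB EZ Ed rho.
have [Cpd CC] := invsqrtmxP hB.
have Cu := sympd_unitmx Cpd; have [Csym _] := Cpd.
rewrite /rho; set C := invsqrtmx B in Cu Csym CC *.
pose M w := (S w)^T *m (A *m C).
have Psym w := tr_row_proj (M w); have Pidem w := row_proj_idem (M w).
have iP : integrable_mx P (fun w => row_proj (M w)).
  move=> i j; apply: (@bounded_integrable _ _ _ _ _ 1).
    exact: measurable_random_row_proj.
  by move=> w; exact: projector_entry_le1.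
have EZE : C *m EZ *m C = expect_mx P (fun w => row_proj (M w)).
  (* Integrability is known for the projector, so [Zmx] is first written as the projector conjugated
     by [invmx C]; the constant factors then leave the expectation and cancel. *)
  rewrite /EZ (_ : (fun w => Zmx A B (S w)) =
      fun w => invmx C *m row_proj (M w) *m invmx C); last first.
    apply/funext => w; rewrite -(conj_Zmx _ _ Csym CC).
    by rewrite -[RHS]mulmxA mulmxK// mulKmx.
  rewrite expect_mulmxr; last exact: integrable_mulmxl.
  by rewrite expect_mulmxl// -mulmxA mulmxKV// mulKVmx.
have EdE : Ed = \tr (C *m EZ *m C).
  rewrite EZE -expect_mxtrace//; congr expect; apply/funext => w.
  (* Right multiplication by the invertible [C] preserves the rank. *)
  have Cfree : row_free C by rewrite row_free_unit.
  by rewrite mxtrace_idem// rank_row_proj /M mulmxA (mxrankMfree _ Cfree).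
have Wsym : (C *m EZ *m C)^T = C *m EZ *m C.
  by rewrite EZE -expect_mx_tr; congr expect_mx; apply/funext => w.
(* Both bounds hold pointwise for the random projector and pass to its expectation by
   monotonicity. *)
have W_ge0 (x : 'cV_n.+1) : 0 <= (x^T *m (C *m EZ *m C) *m x) 0 0.
  rewrite EZE expect_qform// expectE; apply: Rintegral_ge0 => w _.
  exact: qform_projector_ge0.
have W_le1 (x : 'cV_n.+1) :
    (x^T *m (C *m EZ *m C) *m x) 0 0 <= (x^T *m x) 0 0.
  rewrite EZE expect_qform//.
  have <- : expect P (cst ((x^T *m x) 0 0)) = (x^T *m x) 0 0.
    by rewrite /expect expectation_cst.
  rewrite !expectE.
  apply: le_Rintegral => // [||w _]; last exact: qform_projector_le.
    by apply: integrable_mulmxr; exact: integrable_mulmxl.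
  apply: (@bounded_integrable _ _ _ _ _ `|(x^T *m x) 0 0|) => *.
    exact: measurable_cst.
  exact: lexx.
(* Since [Ed] is the trace, [En] yields the first inequality and [lE] the second; [l0] yields the
   third. *)
have /andP[lE En] := lambda_min_mxtrace Wsym W_le1.
have [/(eigenvalue_itv Wsym W_ge0 W_le1)/andP[l0 l1] _] := lambda_minP Wsym.
have n0 : 0 < n.+1%:R :> R by rewrite ltr0n.
split.
- by rewrite subr_ge0 ler_pdivrMr// mul1r EdE.
- by rewrite lerD2l lerN2 ler_pdivlMr// EdE.
- by rewrite gerBl.
- by rewrite specnorm_one_minus.
Qed.
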